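(* Let $\delta<3/2$ be a real number. Then $c_k=\mathcal{O}\left(k^{-\delta}\right)$ as $k\to\infty$ if and only if $R(x)=\mathcal{O}\left(x^{1-\delta}\right)$ as $x\to+\infty$.
   Context: Let $\zeta$ denote the Riemann zeta function. For integers $k\ge 0$ define $$c_k=\sum_{j=0}^k (-1)^j\binom{k}{j}\frac{1}{\zeta(2j+2)}.$$ For real $x$ define the Riesz function (an everywhere convergent power series) $$R(x)=\sum_{k=1}^\infty \frac{(-1)^{k+1}x^k}{(k-1)!\,\zeta(2k)}=x\sum_{k=0}^\infty\frac{(-1)^k x^k}{k!\,\zeta(2k+2)}.$$ The asymptotics are for integers $k\to\infty$ and real $x\to+\infty$. *)

(* Defs.v *)
From HB Require Import structures.
From mathcomp Require Import all_boot all_order all_algebra.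
From mathcomp Require Import all_classical all_reals all_analysis.
Import Order.TTheory GRing.Theory Num.Theory numFieldNormedType.Exports.

Set Implicit Arguments.
Unset Strict Implicit.
Unset Printing Implicit Defensive.

Local Open Scope classical_set_scope.
Local Open Scope ring_scope.

(* The Dirichlet series of the Riemann zeta function, which represents it on
   real s > 1; [limn] is a junk value where the series diverges. Only the
   arguments 2, 4, 6, ... are used below. *)
Definition zeta (R : realType) (s : R) : R :=
  limn (fun n => \sum_(1 <= m < n) m%:R `^ (- s)).

(* Registers x -> +oo as a filter, as required by the Landau notations. *)
Canonical pinfty_nbhs_filterType (R : numFieldType) :=
  FilterType (pinfty_nbhs R) _.

Definition riesz_coef (R : realType) (k : nat) : R :=
  \sum_(0 <= j < k.+1)
    (-1) ^+ j * 'C(k, j)%:R * (zeta (2 * j + 2)%N%:R)^-1.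

Definition riesz (R : realType) (x : R) : R :=
  limn (fun n => \sum_(1 <= k < n)
    ((-1) ^+ k.+1 * x ^+ k) / ((k.-1)`!%:R * zeta (2 * k)%N%:R)).

(* Main.v *)
Require Import Defs.
From HB Require Import structures.
From mathcomp Require Import all_boot all_order all_algebra.
From mathcomp Require Import all_classical all_reals all_analysis.
From mathcomp Require Import ring lra.
Import Order.TTheory GRing.Theory Num.Theory numFieldNormedType.Exports.

(** Let mu be the Moebius function. Since 1 / zeta(2j+2) is the sum over n of
mu(n) n^-2 (n^-2)^j, both objects are averages of a function of t = n^-2
against the same absolutely summable weights mu(n) n^-2:
  - c_k is the average of (1 - t)^k, by the binomial formula
    ([cvg_moebius_riesz_coef]);
  - R(x) / x is the average F(x) of exp(-x t), by the exponential series
    ([rieszE], where F is [moebius_laplace]).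

The functions (1 - t)^k and exp(-k t) are close: their distance is
O(t exp(-k t / 2)) on [0, 1]. Likewise exp(-x t) and exp(-y t) differ by at
most t exp(-y t) when y <= x <= y + 1. Bounding |mu| by 1, both errors are
controlled by the positive sum of n^-4 exp(-x / n^2), which is at most
8 x^(-3/2) ([sum_kernel_le]). Hence c_k = F(k) + O(k^(-3/2))
([riesz_coef_laplace_dist]) and F(x) = F(k) + O(k^(-3/2)) for
k <= x <= k + 1 ([moebius_laplace_lip]). When delta < 3/2 these errors are
O(k^(-delta)), so c_k = O(k^(-delta)), F(x) = O(x^(-delta)) and
R(x) = O(x^(1-delta)) are equivalent. *)

Set Implicit Arguments.
Unset Strict Implicit.
Unset Printing Implicit Defensive.

Local Open Scope classical_set_scope.
Local Open Scope ring_scope.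

(** * The Moebius function *)

Definition moebius (R : pzRingType) (n : nat) : R :=
  if all (fun p => logn p n == 1%N) (primes n) then (-1) ^+ size (primes n)
  else 0.

Lemma normr_moebius_le1 (R : numDomainType) n : `|moebius R n| <= 1.
Proof.
rewrite /moebius; case: ifP => _; last by rewrite normr0.
by rewrite normrX normrN1 expr1n.
Qed.

Lemma moebius1 (R : pzRingType) : moebius R 1%N = 1.
Proof. by []. Qed.

Lemma moebius_mul_prime (R : pzRingType) p n : prime p -> (0 < n)%N ->
  moebius R (p * n)%N = if (p %| n)%N then 0 else - moebius R n.
Proof.
move=> p_prime n_gt0; have p_gt0 := prime_gt0 p_prime.
have lognpn q : logn q (p * n)%N = ((q == p) + logn q n)%N.
  by rewrite lognM// logn_prime.
have mem_pn : primes (p * n)%N =i p :: primes n.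
  by move=> q; rewrite primesM// primes_prime// mem_seq1 inE.
case: ifPn => [p_n|p'n].
  rewrite /moebius; case: ifP => // /allP /(_ p).
  rewrite mem_pn mem_head lognpn eqxx /= => /(_ isT) /eqP[].
  by move/eqP; rewrite -leqn0 leqNgt logn_gt0 mem_primes p_prime n_gt0 p_n.
have p'primes : p \notin primes n.
  by rewrite mem_primes (negPf p'n) !andbF.
have primes_pn : perm_eq (primes (p * n)%N) (p :: primes n).
  apply: uniq_perm; rewrite /= ?primes_uniq ?p'primes//.
rewrite /moebius (perm_size primes_pn) (perm_all _ primes_pn) /=.
rewrite lognpn eqxx (eqP (_ : logn p n == 0)); last first.
  by rewrite -leqn0 leqNgt logn_gt0.
have -> : all (fun q => logn q (p * n)%N == 1%N) (primes n) =
          all (fun q => logn q n == 1%N) (primes n).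
  apply: eq_in_all => q q_n; rewrite lognpn.
  by case: (q =P p) q_n => [->|//]; rewrite (negPf p'primes).
by rewrite /=; case: ifP => _; rewrite ?oppr0 // exprS mulN1r.
Qed.

Lemma sum_multiples (V : nmodType) (N d : nat) (Q : pred nat) (F : nat -> V) :
  (0 < d)%N ->
  \sum_(1 <= k < N | (d %| k)%N && Q k) F k =
  \sum_(1 <= m < N | (d * m < N)%N && Q (d * m)%N) F (d * m)%N.
Proof.
move=> d_gt0; rewrite -big_filter -[RHS]big_filter -[RHS](big_map (muln d) xpredT).
apply: perm_big; apply: uniq_perm.
- by rewrite filter_uniq// iota_uniq.
- rewrite map_inj_uniq ?filter_uniq ?iota_uniq//.
  by move=> a b /eqP; rewrite eqn_pmul2l// => /eqP.
move=> k; rewrite mem_filter mem_index_iota; apply/idP/mapP => [|[m]].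
  move=> /andP[/andP[/dvdnP[m ->] Qm] /andP[m_gt0 m_lt]]; exists m; last exact: mulnC.
  rewrite mem_filter mem_index_iota ![(d * m)%N]mulnC m_lt Qm /=.
  move: m_gt0; rewrite muln_gt0 => /andP[-> _] /=.
  by apply: leq_ltn_trans m_lt; rewrite leq_pmulr.
rewrite mem_filter mem_index_iota => /andP[/andP[m_lt Qm] /andP[m_gt0 _]] ->.
by rewrite dvdn_mulr// Qm muln_gt0 d_gt0 m_gt0.
Qed.

(** Take a prime factor p of n. The divisors d = p e with p not dividing e have
[moebius d = - moebius e] and are in bijection with the divisors e of n prime
to p, while [moebius] vanishes on multiples of p^2: everything cancels. *)
Lemma sum_moebius_divisors (R : pzRingType) (N n : nat) : (0 < n < N)%N ->
  \sum_(1 <= d < N | (d %| n)%N) moebius R d = (n == 1%N)%:R.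
Proof.
move=> /andP[n_gt0 n_lt]; case: (ltngtP n 1%N) => [|n_gt1|n1].
- by rewrite ltnNge n_gt0.
- have p_prime := pdiv_prime n_gt1; set p := pdiv n in p_prime.
  rewrite (bigID (fun d => p %| d)%N) /=.
  under eq_bigl do rewrite andbC.
  rewrite sum_multiples ?prime_gt0//.
  rewrite (bigID (fun e => p %| e)%N) /= [X in X + _ + _]big1_seq ?add0r; last first.
    move=> e /andP[/andP[_ p_e]]; rewrite mem_index_iota => /andP[e_gt0 _].
    by rewrite moebius_mul_prime// p_e.
  rewrite -[X in _ + X]opprK -sumrN; apply/eqP; rewrite subr_eq0; apply/eqP.
  rewrite big_nat_cond [RHS]big_nat_cond; apply: eq_big => [e|e].
    case: (boolP (p %| e)%N) => [|p'e]; rewrite ?andbF// !andbT.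
    congr (_ && _); rewrite Gauss_dvd ?prime_coprime// pdiv_dvd /=.
    case: (boolP (e %| n)%N) => e_n; rewrite ?andbF// andbT.
    apply: leq_ltn_trans n_lt; apply: dvdn_leq => //.
    by rewrite Gauss_dvd ?prime_coprime// pdiv_dvd.
  move=> /andP[/andP[e_gt0 _] /andP[_ p'e]].
  by rewrite moebius_mul_prime// (negPf p'e).
- subst n; rewrite big_ltn_cond//= big_nat_cond big1 ?addr0// => d.
  by rewrite dvdn1 => /andP[/andP[d_gt1 _] /eqP d1]; rewrite d1 in d_gt1.
Qed.

(** A truncated form of (sum of mu(n) a(n)) (sum of a(m)) = a(1): keeping
exactly the pairs with n m < N makes the identity free of any limit, so that
only the tails of the inner sum remain to be estimated. *)
Lemma moebius_convolution (R : comPzRingType) (a : nat -> R) (N : nat) :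
  (1 < N)%N -> {morph a : m n / (m * n)%N >-> m * n} ->
  \sum_(1 <= n < N) moebius R n * a n * (\sum_(1 <= m < N | (n * m < N)%N) a m)
  = a 1%N%N.
Proof.
move=> N_gt1 aM.
under eq_big_nat => n /andP[n_gt0 _].
  rewrite -mulrA big_distrr /=.
  under eq_bigr do rewrite -aM.
  under eq_bigl do rewrite -[(_ < N)%N]andbT.
  rewrite -(@sum_multiples _ N n xpredT a)// big_distrr /=.
  under eq_bigl do rewrite andbT.
  rewrite big_mkcond /=.
  over.
rewrite exchange_big /=.
under eq_big_nat => k k_bd.
  rewrite -big_mkcond -big_distrl /= sum_moebius_divisors// mulrC.
  over.
rewrite big_ltn// eqxx mulr1 big_nat_cond big1 ?addr0// => k.
by rewrite andbT; case: eqP => [->//|]; rewrite mulr0.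
Qed.

(** * Averages against the Moebius weights *)

(** The terms are dominated by the telescoping differences 2/m - 2/(m+1). *)
Lemma sum_inv_sq_le (R : realFieldType) (M N : nat) : (0 < M)%N ->
  \sum_(M <= m < N) (m%:R : R) ^- 2 <= 2 / M%:R.
Proof.
move=> M_gt0; have [NM|MN] := leqP N M.
  by rewrite big_geq// divr_ge0.
suff : \sum_(M <= m < N) (m%:R : R) ^- 2 <= 2 / M%:R - 2 / N%:R.
  by move=> /le_trans; apply; rewrite gerBl divr_ge0.
have := telescope_sumr (fun m => - (2 / m%:R : R)) (ltnW MN).
rewrite opprK addrC => <-.
apply: ler_sum_nat => m /andP[Mm _].
have m_ge1 : 1 <= m%:R :> R by rewrite ler1n (leq_trans M_gt0).
rewrite /= -[m.+1%:R]natr1.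
have -> : - (2 / (m%:R + 1)) - - (2 / m%:R) = 2 / (m%:R * (m%:R + 1)) :> R.
  by field; apply/andP; split; lra.
rewrite -[_ ^- 2]mul1r ler_pdivrMr ?exprn_gt0//; last by lra.
rewrite mulrAC ler_pdivlMr; last by apply: mulr_gt0; lra.
by rewrite expr2; nra.
Qed.

Lemma is_cvg_sum_inv_sq (R : realType) (f : nat -> R) (B : R) :
  (forall n, (0 < n)%N -> `|f n| <= B * n%:R ^- 2) ->
  cvgn (fun N => \sum_(1 <= n < N) f n).
Proof.
move=> f_le; 
suff sumS : cvgn (series (fun n => f n.+1)).
  apply: cvgP; rewrite -cvg_shiftS.
  under eq_fun do rewrite big_add1 /=.
  by rewrite seriesEnat in sumS; exact: sumS.
apply: (@normed_cvg _ R (fun n => f n.+1)).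
apply: (series_le_cvg (v_ := fun n => B * n.+1%:R ^- 2)).
- by move=> n; exact: normr_ge0.
- by move=> n; apply: le_trans (f_le n.+1 isT); exact: normr_ge0.
- by move=> n; exact: f_le.
have B_ge0 : 0 <= B.
  by have := le_trans (normr_ge0 _) (f_le 1%N isT); rewrite expr1n invr1 mulr1.
apply: nondecreasing_is_cvgn.
  apply: nondecreasing_series => n _ _.
  by rewrite mulr_ge0// invr_ge0 exprn_ge0.
exists (B * 2) => _ [N _ <-]; rewrite seriesEnat /= -big_distrr ler_wpM2l//=.
have := @sum_inv_sq_le R 1 N.+1 isT; rewrite big_add1 /= => /le_trans; apply.
by rewrite divr1.
Qed.

Lemma natr_inv_sq_itv (R : realFieldType) (n : nat) : (0 < n)%N ->
  0 < (n%:R : R) ^- 2 <= 1.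
Proof.
move=> n_gt0; rewrite invr_gt0 exprn_gt0 ?ltr0n//=.
by rewrite invf_le1 ?exprn_gt0 ?ltr0n// exprn_ege1// ler1n.
Qed.

Definition moebius_psum (R : realType) (g : R -> R) (N : nat) : R :=
  \sum_(1 <= n < N) moebius R n * n%:R ^- 2 * g (n%:R ^- 2).

Lemma is_cvg_moebius_psum (R : realType) (g : R -> R) (B : R) :
  (forall t, 0 < t <= 1 -> `|g t| <= B) -> cvgn (moebius_psum g).
Proof.
move=> g_le; apply: (is_cvg_sum_inv_sq (B := B)) => n n_gt0.
have t_itv := natr_inv_sq_itv R n_gt0.
rewrite -mulrA !normrM -[leRHS]mul1r ler_pM ?normr_moebius_le1// mulrC.
by have [t_gt0 _] := andP t_itv; rewrite (gtr0_norm t_gt0) ler_pM2r ?g_le.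
Qed.

(** All estimates go through this comparison, in which the Moebius function
enters only by its bound 1: the dominating sum has nonnegative weights. *)
Lemma moebius_limit_dist_le (R : realType) (g1 g2 h : R -> R) (l1 l2 B : R) :
  moebius_psum g1 @ \oo --> l1 -> moebius_psum g2 @ \oo --> l2 ->
  (forall t, 0 < t <= 1 -> `|g1 t - g2 t| <= h t) ->
  (forall N, \sum_(1 <= n < N) n%:R ^- 2 * h (n%:R ^- 2) <= B) ->
  `|l1 - l2| <= B.
Proof.
move=> cvg1 cvg2 g_le h_le.
have cvg12 : (fun N => `|moebius_psum g1 N - moebius_psum g2 N|) @ \oo
    --> `|l1 - l2|.
  by apply: cvg_norm; apply: cvgB.
rewrite -(cvg_lim _ cvg12)//; apply: limr_le; first exact: cvgP cvg12.
apply: nearW => N /=; apply: le_trans (h_le N).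
rewrite -sumrB (le_trans (ler_norm_sum _ _ _))//.
apply: ler_sum_nat => n /andP[n_gt0 _].
have t_itv := natr_inv_sq_itv R n_gt0.
rewrite -mulrBr -mulrA !normrM -[leRHS]mul1r ler_pM ?normr_moebius_le1//.
by have [t_gt0 _] := andP t_itv; rewrite (gtr0_norm t_gt0) ler_pM2l ?g_le.
Qed.

(** * Reciprocals of zeta values as moments *)

Lemma zeta_even (R : realType) (j : nat) :
  zeta (2 * j + 2)%N%:R =
  limn (fun N => \sum_(1 <= m < N) ((m%:R : R) ^- 2) ^+ j.+1).
Proof.
rewrite /zeta; congr (limn _); apply/funext => N.
apply: eq_bigr => m _; rewrite powR_invn// exprVn -exprM.
by rewrite mulnS addnC.
Qed.

Lemma zeta_even_bounds (R : realType) (j M : nat) : (0 < M)%N ->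
  \sum_(1 <= m < M) (m%:R ^- 2) ^+ j.+1 <= zeta (2 * j + 2)%N%:R :> R /\
  zeta (2 * j + 2)%N%:R <= \sum_(1 <= m < M) (m%:R ^- 2) ^+ j.+1 + 2 / M%:R :> R.
Proof.
move=> M_gt0; pose u N := \sum_(1 <= m < N) ((m%:R : R) ^- 2) ^+ j.+1.
rewrite zeta_even -/u -/(u M).
have u_ge0 m : 0 <= ((m%:R : R) ^- 2) ^+ j.+1.
  by rewrite exprn_ge0// invr_ge0 exprn_ge0.
have term_le m : (0 < m)%N -> ((m%:R : R) ^- 2) ^+ j.+1 <= m%:R ^- 2.
  move=> /(natr_inv_sq_itv R)/andP[t_gt0 t_le1].
  by rewrite exprS ler_piMr ?(ltW t_gt0)// exprn_ile1// ltW.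
have cvg_u : cvgn u.
  apply: (is_cvg_sum_inv_sq (B := 1)) => m m_gt0.
  by rewrite mul1r ger0_norm ?term_le.
have homo_u : nondecreasing_seq u.
  apply/nondecreasing_seqP => -[|N]; first by rewrite /u !big_geq.
  by rewrite /u [leRHS]big_nat_recr//= lerDl.
split; first exact: (nondecreasing_cvgn_le homo_u cvg_u M).
apply: limr_le => //; near=> N.
rewrite /u (big_cat_nat (n := M))//=; last by near: N; exists M.
rewrite lerD2l; apply: le_trans (sum_inv_sq_le R N M_gt0).
apply: ler_sum_nat => m /andP[Mm _]; apply: term_le.
exact: leq_trans Mm.
Unshelve. all: by end_near. Qed.

Lemma zeta_even_gt0 (R : realType) (j : nat) : 0 < zeta (2 * j + 2)%N%:R :> R.
Proof.
have [+ _] := @zeta_even_bounds R j 2 isT.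
by rewrite big_nat1 expr1n invr1 expr1n; apply: lt_le_trans.
Qed.

(** Dominated by twice the Cesaro mean of the harmonic sequence. *)
Lemma cvg_mean_inv (R : realType) :
  (fun N => 2 / N%:R * \sum_(1 <= n < N) (n%:R : R)^-1) @ \oo --> (0 : R).
Proof.
rewrite -cvg_shiftS -cvg_shiftS /=.
have /cesaro mean0 := @cvg_harmonic R.
have mean0' : (fun N => 2 * arithmetic_mean (@harmonic R) N) @ \oo --> (0 : R).
  by rewrite -[X in _ --> X](mulr0 2); apply: cvgMr.
apply: (squeeze_cvgr _ (cvg_cst 0) mean0'); near=> N.
rewrite /arithmetic_mean seriesEnat /= big_add1 /=.
have S_ge0 : 0 <= \sum_(0 <= n < N.+1) (n.+1%:R : R)^-1 by apply: sumr_ge0.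
rewrite mulr_ge0//= mulrA ler_wpM2r// ler_pM2l// lef_pV2 ?posrE//.
by rewrite ler_nat.
Unshelve. all: by end_near. Qed.

(** In [moebius_convolution] with a(n) = n^(-2j-2), the inner sum is a partial
sum of zeta of length about N/n, hence within 2n/N of it. Replacing it by zeta
costs at most the sum over n < N of n^-2 (2n/N), which tends to 0. *)
Lemma cvg_moebius_zeta (R : realType) (j : nat) :
  moebius_psum (fun t => t ^+ j) @ \oo --> (zeta (2 * j + 2)%N%:R : R)^-1.
Proof.
have z_gt0 := zeta_even_gt0 R j; set z := zeta _ in z_gt0 *.
suff cvg1 : (fun N => z * moebius_psum (fun t : R => t ^+ j) N) @ \oo --> (1 : R).
  rewrite -[X in _ --> X]mulr1.
  rewrite [X in X @ _](_ : _ = fun N => z^-1 * (z * moebius_psum (fun t : R => t ^+ j) N)).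
    exact: cvgMr.
  by apply/funext => N; rewrite mulKf// gt_eqF.
pose a (n : nat) : R := (n%:R ^- 2) ^+ j.+1.
have a_ge0 n : 0 <= a n by rewrite exprn_ge0// invr_ge0 exprn_ge0.
have aM : {morph a : m n / (m * n)%N >-> m * n}.
  by move=> m n; rewrite /a natrM exprMn invfM exprMn.
apply/cvgrPdist_le => e e_gt0.
have /cvgrPdist_le /(_ e e_gt0) := @cvg_mean_inv R; apply: filter_app.
near=> N; rewrite sub0r normrN => mean_le; apply: le_trans mean_le.
have N_gt1 : (1 < N)%N by near: N; exists 2%N.
have N_gt0 := ltnW N_gt1.
have a1 : a 1%N = 1 by rewrite /a expr1n invr1 expr1n.
have := moebius_convolution N_gt1 aM; rewrite a1 => conv.
rewrite -[X in `|X - _| <= _]conv.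
rewrite /moebius_psum big_distrr /= -sumrB.
rewrite [leRHS]ger0_norm; last by rewrite mulr_ge0 ?divr_ge0 ?sumr_ge0.
rewrite big_distrr (le_trans (ler_norm_sum _ _ _))//=.
apply: ler_sum_nat => n /andP[n_gt0 nN].
(* M is the least integer with N <= n M, i.e. N / n rounded up. *)
pose M := (N.-1 %/ n).+1.
have -> : \sum_(1 <= m < N | (n * m < N)%N) a m = \sum_(1 <= m < M) a m.
  rewrite [RHS](big_nat_widen _ _ N); last first.
    rewrite /M -[X in (_ < X)%N](prednK N_gt0) ltnS.
    exact: leq_div.
  apply: eq_bigl => m; rewrite /M ltnS leq_divRL// mulnC.
  by rewrite -[N in LHS](prednK N_gt0) ltnS.
have [sum_le sum_ge] := @zeta_even_bounds R j M isT.
rewrite -/z in sum_le sum_ge.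
have -> : moebius R n * a n * (\sum_(1 <= m < M) a m) -
    z * (moebius R n * n%:R ^- 2 * (n%:R ^- 2) ^+ j) =
    moebius R n * (a n * (\sum_(1 <= m < M) a m - z)).
  by rewrite /a exprS; ring.
have n_gt0' : 0 < n%:R :> R by rewrite ltr0n.
have N_gt0' : 0 < N%:R :> R by rewrite ltr0n.
have [t_gt0 t_le1] := andP (natr_inv_sq_itv R n_gt0).
have an_le : a n <= n%:R ^- 2.
  by rewrite /a exprS ler_piMr ?(ltW t_gt0)// exprn_ile1// ltW.
have NnM : N%:R <= n%:R * M%:R :> R.
  rewrite -natrM ler_nat -[N in (N <= _)%N](prednK N_gt0) mulnC /M.
  by rewrite ltn_ceil.
have M_gt0 : 0 < M%:R :> R by rewrite ltr0n.
have tail_le : `|\sum_(1 <= m < M) a m - z| <= 2 * n%:R / N%:R.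
  rewrite distrC ger0_norm ?subr_ge0//.
  apply: (@le_trans _ _ (2 / M%:R)); first by rewrite lerBlDl.
  rewrite ler_pdivrMr// mulrAC ler_pdivlMr// -mulrA.
  by rewrite ler_pM2l.
rewrite !normrM (ger0_norm (a_ge0 n)) -[leRHS]mul1r.
rewrite ler_pM ?mulr_ge0 ?normr_moebius_le1//.
apply: le_trans (ler_pM _ _ an_le tail_le) _ => //.
rewrite le_eqVlt; apply/orP; left; apply/eqP; field.
by rewrite !gt_eqF.
Unshelve. all: by end_near. Qed.

(** * The two families as averages *)

Lemma cvg_moebius_poly (R : realType) (a : nat -> R) (k : nat) :
  moebius_psum (fun t => \sum_(0 <= i < k) a i * t ^+ i) @ \oo -->
  \sum_(0 <= i < k) a i * (zeta (2 * i + 2)%N%:R : R)^-1.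
Proof.
elim: k => [|k IHk].
  rewrite big_geq//; apply: cvg_near_cst; apply: nearW => N.
  by rewrite /moebius_psum big1// => n _; rewrite big_geq// mulr0.
rewrite big_nat_recr//=.
rewrite [X in X @ _](_ : _ = fun N =>
    moebius_psum (fun t => \sum_(0 <= i < k) a i * t ^+ i) N
    + a k * moebius_psum (fun t : R => t ^+ k) N).
  by apply: cvgD => //; apply: cvgMr; exact: cvg_moebius_zeta.
apply/funext => N; rewrite /moebius_psum big_distrr -big_split /=.
by apply: eq_bigr => n _; rewrite big_nat_recr//=; ring.
Qed.

Lemma cvg_moebius_riesz_coef (R : realType) (k : nat) :
  moebius_psum (fun t => (1 - t) ^+ k) @ \oo --> riesz_coef R k.
Proof.
pose a j : R := (-1) ^+ j * 'C(k, j)%:R.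
rewrite (_ : (fun t => _) = fun t => \sum_(0 <= j < k.+1) a j * t ^+ j).
  exact: cvg_moebius_poly.
apply/funext => t.
rewrite exprDn big_mkord; apply: eq_bigr => i _.
by rewrite expr1n mul1r exprNn -mulr_natr mulrAC.
Qed.

(** Bounding the tail at -x t termwise by the tail at x makes the bound uniform
in t, as needed to exchange the exponential series with the sum over n. *)
Lemma expR_taylor_dist (R : realType) (x t : R) (n : nat) :
  0 <= x -> 0 < t <= 1 ->
  `|\sum_(0 <= i < n) (- x) ^+ i / i`!%:R * t ^+ i - expR (- (x * t))|
  <= expR x - series (exp_coeff x) n.
Proof.
move=> x_ge0 /andP[t_gt0 t_le1].
have -> : \sum_(0 <= i < n) (- x) ^+ i / i`!%:R * t ^+ i =
    series (exp_coeff (- (x * t))) n.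
  rewrite seriesEnat; apply: eq_bigr => i _.
  by rewrite /exp_coeff /= -mulNr exprMn mulrAC.
rewrite distrC.
have cvgl : (fun m => `|series (exp_coeff (- (x * t))) m -
    series (exp_coeff (- (x * t))) n|) @ \oo -->
    `|expR (- (x * t)) - series (exp_coeff (- (x * t))) n|.
  apply: cvg_norm; apply: cvgB; last exact: cvg_cst.
  exact: is_cvg_series_exp_coeff.
have cvgr : (fun m => series (exp_coeff x) m - series (exp_coeff x) n) @ \oo -->
    expR x - series (exp_coeff x) n.
  by apply: cvgB; [exact: is_cvg_series_exp_coeff | exact: cvg_cst].
rewrite -(cvg_lim _ cvgl)// -(cvg_lim _ cvgr)//.
apply: ler_lim; [exact: cvgP cvgl | exact: cvgP cvgr |].
near=> m; have nm : (n <= m)%N by near: m; exists n.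
rewrite !sub_series_geq//.
rewrite (le_trans (ler_norm_sum _ _ _))//; apply: ler_sum => i _.
rewrite /exp_coeff /= normrM [X in _ * X]ger0_norm ?invr_ge0//.
rewrite ler_pM2r ?invr_gt0 ?ltr0n ?fact_gt0// normrX normrN.
have xt_ge0 : 0 <= x * t by rewrite mulr_ge0// ltW.
by rewrite ger0_norm// lerXn2r ?nnegrE// ler_piMr.
Unshelve. all: by end_near. Qed.

Definition moebius_laplace (R : realType) (x : R) : R :=
  limn (moebius_psum (fun t => expR (- (x * t)))).

Lemma cvg_moebius_laplace (R : realType) (x : R) : 0 <= x ->
  moebius_psum (fun t => expR (- (x * t))) @ \oo --> moebius_laplace x.
Proof.
move=> x_ge0; apply: (is_cvg_moebius_psum (B := 1)) => t /andP[t_gt0 _].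
by rewrite gtr0_norm ?expR_gt0// expR_le1 oppr_le0 mulr_ge0// ltW.
Qed.

(** Exchange of summations: the partial sums of the Riesz series are the averages
of the Taylor polynomials of exp(-x t), which converge uniformly in t. *)
Lemma rieszE (R : realType) (x : R) : 0 <= x ->
  riesz x = x * moebius_laplace x.
Proof.
move=> x_ge0.
pose P n : R := \sum_(0 <= i < n) (- x) ^+ i / i`!%:R * (zeta (2 * i + 2)%N%:R)^-1.
have P_cvg : P @ \oo --> moebius_laplace x.
  have tail0 : (fun n => 2 * (expR x - series (exp_coeff x) n)) @ \oo --> (0 : R).
    rewrite -[X in _ --> X](mulr0 2) -[X in 2 * X](subrr (expR x)).
    apply: cvgMr; apply: cvgB; first exact: cvg_cst.
    exact: is_cvg_series_exp_coeff.
  apply/cvgrPdist_le => e e_gt0.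
  have /cvgrPdist_le /(_ e e_gt0) := tail0; apply: filter_app.
  near=> n; rewrite sub0r normrN => /(le_trans (ler_norm _)).
  apply: le_trans; rewrite distrC.
  apply: (@moebius_limit_dist_le R _ _ (fun=> expR x - series (exp_coeff x) n)
    _ _ _ (@cvg_moebius_poly R (fun i => (- x) ^+ i / i`!%:R) n) (cvg_moebius_laplace x_ge0)).
    by move=> t; exact: expR_taylor_dist.
  move=> N; rewrite -big_distrl /=; apply: ler_wpM2r.
    have t1 : 0 < (1 : R) <= 1 by rewrite ltr01 lexx.
    exact: le_trans (normr_ge0 _) (expR_taylor_dist n x_ge0 t1).
  by rewrite (le_trans (sum_inv_sq_le _ _ _))// divr1.
rewrite /riesz; apply/cvg_lim => //; rewrite -cvg_shiftS /=.
rewrite [X in X @ _](_ : _ = fun n => x * P n); first exact: cvgMr.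
apply/funext => n; rewrite big_add1 /= /P big_distrr /=.
apply: eq_bigr => i _; rewrite mulnS [(2 + _)%N]addnC invfM.
by rewrite !exprS [(- x) ^+ i]exprNn /=; ring.
Unshelve. all: by end_near. Qed.

(** * The kernel estimate *)

(** With x = s^2, this combines exp(-y) <= 4 / (1 + y)^2 at y = x / t^2, which
turns the left side into 4 / (t^2 + x)^2, with t^2 + x >= x for one factor and
2 (t^2 + s^2) >= (t + s)^2 for the other. The point of the shifted square is
that its sum over integers t telescopes. *)
Lemma inv_sq_expR_le (R : realType) (s t : R) : 0 < s -> 0 < t ->
  t ^- 2 * (t ^- 2 * expR (- (s ^+ 2 * t ^- 2))) <= 8 / s ^+ 2 * (t + s) ^- 2.
Proof.
move=> s_gt0 t_gt0; set y := s ^+ 2 * t ^- 2.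
have y_ge0 : 0 <= y by rewrite mulr_ge0 ?invr_ge0 ?exprn_ge0 ?ltW.
have ey : (1 + y) ^+ 2 / 4 <= expR y.
  have -> : expR y = expR (y / 2) ^+ 2 by rewrite -expRM_natl; congr expR; field.
  have -> : (1 + y) ^+ 2 / 4 = ((1 + y) / 2) ^+ 2 by field.
  rewrite lerXn2r ?nnegrE ?expR_ge0//; first by lra.
  by have := expR_ge1Dx (y / 2); lra.
have t2_gt0 : 0 < t ^+ 2 by rewrite exprn_gt0.
have s2_gt0 : 0 < s ^+ 2 by rewrite exprn_gt0.
have st_gt0 : 0 < t ^+ 2 + s ^+ 2 by rewrite addr_gt0.
rewrite expRN.
apply: (@le_trans _ _ (t ^- 2 * (t ^- 2 * ((1 + y) ^+ 2 / 4)^-1))).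
  rewrite !ler_pM2l ?invr_gt0// lef_pV2// posrE ?expR_gt0//.
  by rewrite divr_gt0// exprn_gt0// ltr_wpDr.
have -> : t ^- 2 * (t ^- 2 * ((1 + y) ^+ 2 / 4)^-1) = 4 / (t ^+ 2 + s ^+ 2) ^+ 2.
  by rewrite /y; field; rewrite !gt_eqF.
have ts1_gt0 : 0 < t + s by rewrite addr_gt0.
have ts_gt0 : 0 < (t + s) ^+ 2 by rewrite exprn_gt0.
rewrite ler_pdivrMr ?exprn_gt0//.
have -> : 8 / s ^+ 2 / (t + s) ^+ 2 * (t ^+ 2 + s ^+ 2) ^+ 2 =
    8 * (t ^+ 2 + s ^+ 2) ^+ 2 / (s ^+ 2 * (t + s) ^+ 2).
  by field; rewrite !gt_eqF.
rewrite ler_pdivlMr ?mulr_gt0//.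
have -> : 8 * (t ^+ 2 + s ^+ 2) ^+ 2 =
    4 * ((t ^+ 2 + s ^+ 2) * (2 * (t ^+ 2 + s ^+ 2))) by ring.
rewrite ler_pM2l//; apply: ler_pM; rewrite ?(ltW s2_gt0) ?(ltW ts_gt0)//.
  by rewrite lerDr ltW.
by have := sqr_ge0 (t - s); nra.
Qed.

Lemma sum_inv_shift_sq_le (R : realFieldType) (s : R) (N : nat) : 0 < s ->
  \sum_(1 <= n < N) (n%:R + s) ^- 2 <= s^-1.
Proof.
move=> s_gt0; case: N => [|N]; first by rewrite big_geq// invr_ge0 ltW.
suff : \sum_(1 <= n < N.+1) (n%:R + s) ^- 2 <= s^-1 - (N%:R + s)^-1.
  by move=> /le_trans; apply; rewrite gerBl invr_ge0 addr_ge0// ltW.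
rewrite big_add1 /=.
have := telescope_sumr (fun n => - (n%:R + s)^-1) (leq0n N).
rewrite opprK addrC add0r => <-.
apply: ler_sum_nat => n _ /=.
rewrite -[n.+1%:R]natr1; have := ler0n R n; set a := n%:R => a_ge0.
have -> : - (a + 1 + s)^-1 - - (a + s)^-1 = ((a + s) * (a + 1 + s))^-1.
  by field; apply/andP; split; lra.
by rewrite lef_pV2 ?posrE ?exprn_gt0 ?mulr_gt0//; lra.
Qed.

Lemma sum_kernel_le (R : realType) (x : R) (N : nat) : 0 < x ->
  \sum_(1 <= n < N) n%:R ^- 2 * (n%:R ^- 2 * expR (- (x * n%:R ^- 2)))
  <= 8 * x `^ (- (3 / 2)).
Proof.
move=> x_gt0; pose s := x `^ 2^-1.
have s_gt0 : 0 < s by rewrite powR_gt0.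
have s2 : s ^+ 2 = x by rewrite -powR_mulrn ?ltW// -powRrM mulVf// powRr1// ltW.
have -> : 8 * x `^ (- (3 / 2)) = 8 / s ^+ 2 * s^-1.
  rewrite powRN mulrC [3 / 2]mulrC powRrM -/s powR_mulrn ?ltW//.
  by field; rewrite gt_eqF.
rewrite -{1}s2.
apply: (@le_trans _ _ (\sum_(1 <= n < N) 8 / s ^+ 2 * (n%:R + s) ^- 2)).
  by apply: ler_sum_nat => n /andP[n_gt0 _]; apply: inv_sq_expR_le; rewrite ?ltr0n.
rewrite -big_distrr ler_wpM2l ?sum_inv_shift_sq_le//.
by rewrite divr_ge0// exprn_ge0// ltW.
Qed.

(** * Comparison of the two averages *)

Lemma moebius_laplace_lip (R : realType) (x y : R) : 0 < y <= x -> x <= y + 1 ->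
  `|moebius_laplace x - moebius_laplace y| <= 8 * y `^ (- (3 / 2)).
Proof.
move=> /andP[y_gt0 yx] xy1; have x_ge0 := le_trans (ltW y_gt0) yx.
apply: (@moebius_limit_dist_le R _ _ (fun t => t * expR (- (y * t))) _ _ _
  (cvg_moebius_laplace x_ge0) (cvg_moebius_laplace (ltW y_gt0))); last first.
  by move=> N; exact: sum_kernel_le.
move=> t /andP[t_gt0 t_le1].
have -> : - (x * t) = - (y * t) + - ((x - y) * t) by ring.
rewrite expRD -{2}[expR (- (y * t))]mulr1 -mulrBr normrM mulrC.
rewrite (gtr0_norm (expR_gt0 _)) ler_pM2r ?expR_gt0// distrC.
have xyt_ge0 : 0 <= (x - y) * t by rewrite mulr_ge0 ?subr_ge0// ltW.
rewrite ger0_norm; last by rewrite subr_ge0 expR_le1 oppr_le0.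
have := expR_ge1Dx (- ((x - y) * t)).
have : (x - y) * t <= t by apply: ler_piMl; [exact: ltW | lra].
by lra.
Qed.

Lemma subX_le (R : realDomainType) (a b : R) (k : nat) : 0 <= a <= b ->
  b ^+ k.+1 - a ^+ k.+1 <= k.+1%:R * (b - a) * b ^+ k.
Proof.
move=> /andP[a_ge0 ab]; have b_ge0 := le_trans a_ge0 ab.
elim: k => [|k IHk]; first by rewrite !expr1 expr0 mul1r mulr1.
have -> : b ^+ k.+2 - a ^+ k.+2 =
    b * (b ^+ k.+1 - a ^+ k.+1) + (b - a) * a ^+ k.+1 by rewrite !exprS; ring.
have -> : k.+2%:R * (b - a) * b ^+ k.+1 =
    b * (k.+1%:R * (b - a) * b ^+ k) + (b - a) * b ^+ k.+1.
  by rewrite -[k.+2%:R]natr1 [b ^+ k.+1]exprS; ring.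
by rewrite lerD ?ler_wpM2l ?subr_ge0// lerXn2r.
Qed.

(** For 0 <= a <= b one has b^k - a^k <= k (b - a) b^(k-1); with a = 1 - t and
b = exp(-t) <= 1 - t + t^2 the difference is at most
k t^2 exp(t) exp(-k t). Half of the exponential absorbs the factor k t, which
leaves the kernel t exp(-k t / 2). *)
Lemma expR_sub_pow_le (R : realType) (k : nat) (t : R) : (0 < k)%N -> 0 < t <= 1 ->
  `|(1 - t) ^+ k - expR (- (k%:R * t))| <=
  2 * expR 1 * (t * expR (- (k%:R / 2 * t))).
Proof.
case: k => // k _ /andP[t_gt0 t_le1]; rewrite distrC.
have tb : 1 - t <= expR (- t) by exact: expR_ge1Dx.
(* exp(-t) <= 1 / (1 + t), and (1 - t + t^2) (1 + t) = 1 + t^3. *)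
have bt : expR (- t) - (1 - t) <= t ^+ 2.
  rewrite expRN lerBlDr -[_^-1]mul1r ler_pdivrMr ?expR_gt0//.
  have := expR_ge1Dx t; set e := expR t => e_ge.
  apply: (@le_trans _ _ ((t ^+ 2 + (1 - t)) * (1 + t))).
    have : 0 <= t ^+ 3 by rewrite exprn_ge0// ltW.
    by rewrite exprS; nra.
  by rewrite ler_wpM2l// addr_ge0 ?sqr_ge0// subr_ge0.
rewrite -mulrN expRM_natl ger0_norm; last first.
  by rewrite subr_ge0 lerXn2r ?nnegrE ?subr_ge0// expR_ge0.
have /(subX_le k)/le_trans : 0 <= 1 - t <= expR (- t) by rewrite subr_ge0 t_le1.
apply.
pose y := k.+1%:R / 2 * t.
have y_ge0 : 0 <= y by rewrite mulr_ge0 ?divr_ge0// ltW.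
have -> : expR (- t) ^+ k = expR t * (expR (- y) * expR (- y)).
  rewrite -expRM_natl -!expRD; congr expR; rewrite /y -[k.+1%:R]natr1.
  by field.
have et : expR t <= expR 1 by rewrite ler_expR.
have ey : y * expR (- y) <= 1.
  rewrite expRN ler_pdivrMr ?expR_gt0// mul1r.
  by have := expR_ge1Dx y; lra.
apply: (@le_trans _ _ (k.+1%:R * t ^+ 2 * (expR 1 * (expR (- y) * expR (- y))))).
  rewrite ler_pM ?mulr_ge0 ?expR_ge0 ?subr_ge0// ?ler_wpM2l//.
  by rewrite ler_wpM2r// mulr_ge0// expR_ge0.
have -> : k.+1%:R * t ^+ 2 * (expR 1 * (expR (- y) * expR (- y))) =
   2 * expR 1 * (t * expR (- y)) * (y * expR (- y)) by rewrite /y; field.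
rewrite -[leRHS]mulr1 ler_wpM2l// !mulr_ge0 ?expR_ge0//.
exact: ltW.
Qed.

Lemma riesz_coef_laplace_dist (R : realType) : exists2 C : R, 0 < C &
  forall k : nat, (0 < k)%N ->
    `|riesz_coef R k - moebius_laplace k%:R| <= C * k%:R `^ (- (3 / 2)).
Proof.
exists (2 * expR 1 * (8 * 2^-1 `^ (- (3 / 2)))) => [|k k_gt0].
  by rewrite !mulr_gt0 ?expR_gt0// powR_gt0.
pose h t : R := 2 * expR 1 * (t * expR (- (k%:R / 2 * t))).
apply: (moebius_limit_dist_le (h := h) (@cvg_moebius_riesz_coef R k)
  (cvg_moebius_laplace (ler0n R k))).
  by move=> t; exact: expR_sub_pow_le.
move=> N; under eq_bigr do rewrite mulrCA.
rewrite -big_distrr -[leRHS]mulrA ler_wpM2l ?mulr_ge0 ?expR_ge0//=.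
apply: le_trans (sum_kernel_le _ _) _; first by rewrite divr_gt0// ltr0n.
by rewrite powRM// -mulrA [X in 8 * X]mulrC.
Qed.

(** Transfers power bounds between a real number x >= 1 and its integer part. *)
Lemma powR_double_le (R : realType) (r x y : R) : 0 < y <= x -> x <= 2 * y ->
  y `^ r <= 2 `^ `|r| * x `^ r.
Proof.
move=> /andP[y_gt0 yx] x2y; have x_gt0 := lt_le_trans y_gt0 yx.
have [r_ge0|r_lt0] := leP 0 r.
  rewrite -[leLHS]mul1r ler_pM ?powR_ge0//.
    by rewrite -[leLHS](powRr0 2) ler_powR ?normr_ge0// ler1n.
  by apply: ge0_ler_powR; rewrite ?nnegrE ?(ltW y_gt0) ?(ltW x_gt0).
pose s := - r; have s_ge0 : 0 <= s by rewrite oppr_ge0 ltW.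
have -> : r = - s by rewrite opprK.
rewrite normrN ger0_norm//.
rewrite !(powRN _ s) ler_pdivlMr ?powR_gt0// mulrC ler_pdivrMr ?powR_gt0//.
rewrite -powRM ?(ltW y_gt0)//.
by apply: ge0_ler_powR; rewrite ?nnegrE ?(ltW x_gt0) ?mulr_ge0 ?(ltW y_gt0).
Qed.

Theorem theorem1 (R : realType) (delta : R) (hdelta : delta < 3 / 2) :
  (fun k : nat => riesz_coef R k) =O_\oo (fun k : nat => k%:R `^ (- delta) : R)
  <->
  (fun x : R => riesz x) =O_ (pinfty_nbhs R) (fun x : R => x `^ (1 - delta)).
Proof.
have [C C_gt0 coef_near] := riesz_coef_laplace_dist R.
have err_le y : 1 <= y -> y `^ (- (3 / 2)) <= y `^ (- delta).
  by move=> y_ge1; rewrite ler_powR// lerN2 ltW.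
have rieszN x : 0 < x -> `|riesz x| = x * `|moebius_laplace x|.
  by move=> x_gt0; rewrite rieszE ?ltW// normrM gtr0_norm.
have powx x : 0 < x -> x `^ (1 - delta) = x * x `^ (- delta).
  by move=> x_gt0; rewrite powRD ?(gt_eqF x_gt0) ?implybT// powRr1// ltW.
split=> /eqO_exP[A A_gt0 bound]; apply/eqO_exP.
- move: bound => -[K _ bound].
  exists ((A + C + 8) * 2 `^ `|- delta|).
    by rewrite /= mulr_gt0 ?powR_gt0// addr_gt0// addr_gt0.
  near=> x.
  have x_ge : K.+1%:R <= x by near: x; apply: nbhs_pinfty_ge; rewrite num_real.
  have x_ge0 : 0 <= x by apply: le_trans x_ge.
  have x_gt0 : 0 < x by apply: lt_le_trans x_ge; rewrite ltr0n.
  have /andP[kx xk1] := truncn_itv x_ge0; set k := Num.truncn x in kx xk1.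
  have Kk : (K.+1 <= k)%N by rewrite -ltnS -(ltr_nat R); exact: le_lt_trans xk1.
  have k_gt0 : (0 < k)%N by exact: leq_trans Kk.
  have k_ge1 : 1 <= k%:R :> R by rewrite ler1n.
  have k_gt0' : 0 < k%:R :> R by rewrite ltr0n.
  have xk1' : x <= k%:R + 1 by rewrite natr1 ltW.
  have coef_le := bound k (ltnW Kk).
  rewrite (ger0_norm (powR_ge0 _ _)) in coef_le.
  rewrite rieszN// powx// [X in _ <= _ * X]ger0_norm ?mulr_ge0 ?powR_ge0//.
  rewrite mulrCA ler_pM2l// -mulrA.
  have kdelta : k%:R `^ (- delta) <= 2 `^ `|- delta| * x `^ (- delta).
    by apply: powR_double_le; rewrite ?k_gt0' //=; lra.
  have lap_le : `|moebius_laplace x| <= (A + C + 8) * k%:R `^ (- delta).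
    have kx' : 0 < (k%:R : R) <= x by apply/andP.
    have := moebius_laplace_lip kx' xk1'.
    have := coef_near k k_gt0.
    have := err_le _ k_ge1.
    set e := _ `^ (- (3 / 2)); set d := _ `^ (- delta) in coef_le *.
    set L := moebius_laplace x; set l := moebius_laplace k%:R.
    set c := riesz_coef R k in coef_le * => e_le cl Ll.
    have -> : L = (L - l) - (c - l) + c by ring.
    apply: le_trans (ler_normD _ _) _.
    have := ler_normB (L - l) (c - l).
    have : C * e <= C * d by rewrite ler_pM2l.
    by lra.
  apply: le_trans lap_le _; rewrite ler_pM2l//.
  by rewrite addr_gt0// addr_gt0.
- move: bound => -[M [M_real bound]].
  exists (A + C); first by rewrite /= addr_gt0.
  near=> k.
  have k_gt0 : (0 < k)%N by near: k; exists 1%N.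
  have k_gt0' : 0 < k%:R :> R by rewrite ltr0n.
  have k_ge1 : 1 <= k%:R :> R by rewrite ler1n.
  have Mk : M < k%:R.
    near: k; exists (Num.bound `|M|) => // n /= Mn.
    apply: lt_le_trans (_ : (Num.bound `|M|)%:R <= _); last by rewrite ler_nat.
    by apply: le_lt_trans (ler_norm _) _; exact: archi_boundP (normr_ge0 _).
  have := bound _ Mk; rewrite rieszN// powx//.
  rewrite [X in _ <= _ * X]ger0_norm ?mulr_ge0 ?powR_ge0// mulrCA ler_pM2l//.
  rewrite [X in _ -> _ <= _ * X]ger0_norm ?powR_ge0//.
  have := coef_near k k_gt0; have := err_le _ k_ge1.
  set e := _ `^ (- (3 / 2)); set d := _ `^ (- delta).
  set l := moebius_laplace k%:R; set c := riesz_coef R k => e_le cl l_le.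
  have -> : c = (c - l) + l by ring.
  apply: le_trans (ler_normD _ _) _.
  have : C * e <= C * d by rewrite ler_pM2l.
  by lra.
Unshelve. all: by end_near. Qed.
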